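(* Consider any stochastic block model $\mathrm{SBM}(p,Q)$. Then: 1. For any $t\ge 5$, $\Psi_{\mathrm{SBM}(p,Q)}(\mathrm{Cyc}_t)\le\Psi_{\mathrm{SBM}(p,Q)}(\mathrm{Cyc}_4)$. 2. If a graph $H$ has a vertex of degree $d$, then $|\Phi_{\mathrm{SBM}(p,Q)}(H)|\le|\Phi_{\mathrm{SBM}(p,Q)}(K_{2,d})|^{1/2}$. 3. Let $K_4^-$ be the graph on $4$ vertices with $5$ edges. Then $\Psi_{\mathrm{SBM}(p,Q)}(K_4^-)\le\Psi_{\mathrm{SBM}(p,Q)}(\mathrm{Cyc}_4)$.
   Context: Graphs are finite, simple and undirected. $\mathrm{Cyc}_t$ is the cycle on $t$ vertices and $K_{2,d}$ the complete bipartite graph with parts of sizes $2$ and $d$. A stochastic block model on $k$ communities is given by a probability vector $p=(p_1,\dots,p_k)\in(0,1]^k$ and a symmetric matrix $Q\in[-1,1]^{k\times k}$. A sample $\mathbf{G}\sim\mathrm{SBM}(n;p,Q)$ is an $n$-vertex graph produced by drawing i.i.d. labels $\mathbf{x}_1,\dots,\mathbf{x}_n\in[k]$ with pmf $p$, and then including each edge $(i,j)$ independently with probability $(1+Q_{\mathbf{x}_i,\mathbf{x}_j})/2$. For a graph $H$ (placed on any $|V(H)|$ of the vertices, $n\ge|V(H)|$), the Fourier coefficient is $\Phi_{\mathrm{SBM}(p,Q)}(H)=\mathbb{E}_{\mathbf{G}\sim\mathrm{SBM}(n;p,Q)}\big[\prod_{(i,j)\in E(H)}(2\mathbf{G}_{ij}-1)\big]$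 (independent of $n$ and of the placement), and $\Psi_{\mathrm{SBM}(p,Q)}(H)=|\Phi_{\mathrm{SBM}(p,Q)}(H)|^{1/|V(H)|}$. *)

(* Defs.v *)
From HB Require Import structures.
From mathcomp Require Import all_boot all_order all_algebra.
From mathcomp Require Import all_reals exp.

Set Implicit Arguments.
Unset Strict Implicit.
Unset Printing Implicit Defensive.

Import Order.TTheory GRing.Theory Num.Theory.
Local Open Scope ring_scope.

Section SimpleGraphs.
Variable V : finType.

Definition is_sgraph (A : {set V * V}) : bool :=
  [forall u, (u, u) \notin A] &&
  [forall u, forall v, ((u, v) \in A) == ((v, u) \in A)].

(* A simple graph is the set of its adjacent ordered pairs; being a subtype of
   a finType, simple graphs on V can be summed over. *)
Record sgraph := SGraph {
  adj_set : {set V * V};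
  adj_setP : is_sgraph adj_set
}.

HB.instance Definition _ := [isSub for adj_set].
HB.instance Definition _ := [Finite of sgraph by <:].

Definition adj (G : sgraph) (u v : V) : bool := (u, v) \in adj_set G.

Definition degree (G : sgraph) (u : V) : nat := #|[set v | adj G u v]|.

(* Symmetric and irreflexive, hence simple, whatever e is. *)
Definition rel_closure (e : rel V) : {set V * V} :=
  [set a : V * V | (a.1 != a.2) && (e a.1 a.2 || e a.2 a.1)].

Lemma rel_closureP (e : rel V) : is_sgraph (rel_closure e).
Proof.
apply/andP; split; first by apply/forallP => u; rewrite inE eqxx.
by apply/forallP => u; apply/forallP => v;
   rewrite !inE /= (eq_sym u v) (orbC (e u v)).
Qed.

Definition sgraph_of_rel (e : rel V) : sgraph := SGraph (rel_closureP e).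

End SimpleGraphs.

Definition Cyc (t : nat) : sgraph 'I_t :=
  sgraph_of_rel (fun i j : 'I_t => j == (i.+1 %% t)%N :> nat).

Definition K_2 (d : nat) : sgraph 'I_(2 + d) :=
  sgraph_of_rel (fun i j : 'I_(2 + d) => (i < 2 <= j)%N).

(* All pairs i < j except (0, 1). *)
Definition K4minus : sgraph 'I_4 :=
  sgraph_of_rel (fun i j : 'I_4 => (i < j)%N && (1 < j)%N).

Section StochasticBlockModel.
Variables (R : realType) (k : nat).

Definition is_sbm (p : 'I_k -> R) (Q : 'M[R]_k) : Prop :=
  [/\ forall a, 0 < p a <= 1,
      \sum_a p a = 1,
      forall a b, Q a b = Q b a
    & forall a b, -1 <= Q a b <= 1].

Variables (p : 'I_k -> R) (Q : 'M[R]_k).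

Definition label_pmf (n : nat) (x : {ffun 'I_n -> 'I_k}) : R :=
  \prod_(i < n) p (x i).

Definition edge_prob (a b : 'I_k) : R := (1 + Q a b) / 2.

(* Each unordered pair {i, j} is represented once, by i < j. *)
Definition graph_pmf_given (n : nat) (x : {ffun 'I_n -> 'I_k})
    (G : sgraph 'I_n) : R :=
  \prod_(i < n) \prod_(j < n | (i < j)%N)
    (if adj G i j then edge_prob (x i) (x j) else 1 - edge_prob (x i) (x j)).

Definition sbm_pmf (n : nat) (G : sgraph 'I_n) : R :=
  \sum_(x : {ffun 'I_n -> 'I_k}) label_pmf x * graph_pmf_given x G.

Definition sbm_expectation (n : nat) (f : sgraph 'I_n -> R) : R :=
  \sum_(G : sgraph 'I_n) sbm_pmf G * f G.

Definition fourier_char (n : nat) (H G : sgraph 'I_n) : R :=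
  \prod_(i < n) \prod_(j < n | (i < j)%N && adj H i j)
    (2 * (adj G i j)%:R - 1).

(* The Fourier coefficient does not depend on the number of sampled vertices
   nor on where H is placed, so the sample is drawn on V(H) itself. *)
Definition Phi (h : nat) (H : sgraph 'I_h) : R :=
  sbm_expectation (fourier_char H).

Definition Psi (h : nat) (H : sgraph 'I_h) : R :=
  `|Phi H| `^ (h%:R^-1).

End StochasticBlockModel.

(* Main.v *)
Require Import Defs.
From mathcomp Require Import all_boot all_order all_algebra.
From mathcomp Require Import all_reals exp.
From mathcomp Require Import ring lra zify.

(* Averaging out the edges gives Phi(H) = E_x prod_{ij in E(H)} Q(x_i, x_j).
   - Cycles: with D = diag(p) and M = sqrt(D) Q sqrt(D) this is tr(M^t), and
     Cauchy-Schwarz and submultiplicativity of the Frobenius norm F bound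
     tr(M^t) by F(M^2)^(t/2), where F(M^2)^2 = tr(M^4): split
     M^(2s) = M^2 M^(2s-2), and M^(2s+1) = M^(2s-2) M^3 with
     F(M^3)^2 = tr(M^6) <= F(M^2)^3.
   - Degree d: averaging over the label of v leaves a product of edges not
     touching v, bounded by 1, times g = E_a prod_{j ~ v} Q(a, x_j); by
     Cauchy-Schwarz Phi(H)^2 <= E g^2, which is Phi(K_{2,d}).
   - K_4^-: with S(c, d) = E_a Q(a, c) Q(a, d), Phi(K_4^-) is E[Q S^2] while
     Phi(Cyc_4) is E[S^2]. *)

Set Implicit Arguments.
Unset Strict Implicit.
Unset Printing Implicit Defensive.

Import Order.TTheory GRing.Theory Num.Theory.
Local Open Scope ring_scope.

(** * Weighted Cauchy-Schwarz for finite sums *)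

Lemma sum_CauchySchwarz (R : realDomainType) (I : finType) (w f g : I -> R) :
  (forall i, 0 <= w i) ->
  (\sum_i w i * (f i * g i)) ^+ 2
    <= (\sum_i w i * f i ^+ 2) * (\sum_i w i * g i ^+ 2).
Proof.
move=> w0; rewrite expr2 !big_distrlr /=.
set A := \sum_i \sum_j _; set B := \sum_i \sum_j _.
have BE : B = \sum_i \sum_j w i * w j * (g i ^+ 2 * f j ^+ 2).
  rewrite /B exchange_big /=; apply: eq_bigr => i _; apply: eq_bigr => j _.
  by ring.
(* Lagrange's identity: this sum of weighted squared minors is twice the gap between the two sides.
   [BE] supplies the copy of [B] with [i] and [j] exchanged. *)
have : 0 <= \sum_i \sum_j w i * w j * (f i * g j - f j * g i) ^+ 2.
  apply: sumr_ge0 => i _; apply: sumr_ge0 => j _.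
  by rewrite mulr_ge0 ?sqr_ge0 ?mulr_ge0.
suff -> : \sum_i \sum_j w i * w j * (f i * g j - f j * g i) ^+ 2
   = B + B - 2 * A by lra.
rewrite {2}BE /A /B mulr_sumr -!big_split -sumrB /=; apply: eq_bigr => i _.
rewrite mulr_sumr -!big_split -sumrB /=; apply: eq_bigr => j _.
by ring.
Qed.

Lemma sum_mul_CauchySchwarz (R : realDomainType) (I : finType)
    (f g : I -> R) :
  (\sum_i f i * g i) ^+ 2 <= (\sum_i f i ^+ 2) * (\sum_i g i ^+ 2).
Proof.
have := sum_CauchySchwarz f g (fun=> ler01).
by under eq_bigr do rewrite mul1r; under [X in _ <= X * _]eq_bigr do
  rewrite mul1r; under [X in _ <= _ * X]eq_bigr do rewrite mul1r.
Qed.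

(** * Frobenius norm and traces of matrix powers *)

Section Matrices.
Variables (R : realDomainType) (k : nat).
Implicit Types A B M : 'M[R]_k.

Definition frob2 A : R := \sum_i \sum_j A i j ^+ 2.

Lemma frob2_ge0 A : 0 <= frob2 A.
Proof. by do 2!apply: sumr_ge0 => ? _; exact: sqr_ge0. Qed.

Lemma frob2_mul A B : frob2 (A * B) <= frob2 A * frob2 B.
Proof.
rewrite /frob2 [X in _ <= _ * X]exchange_big big_distrlr /=.
apply: ler_sum => i _; apply: ler_sum => j _.
by rewrite mxE; exact: sum_mul_CauchySchwarz.
Qed.

Lemma frob2_exp A m : frob2 (A ^+ m.+1) <= frob2 A ^+ m.+1.
Proof.
elim: m => [//|m IH]; rewrite exprS [leRHS]exprS.
apply: le_trans (frob2_mul _ _) _.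
by rewrite ler_wpM2l ?frob2_ge0.
Qed.

(** The trace of a product is the entrywise inner product of [A] with the transpose of [B], so
    Cauchy-Schwarz over index pairs applies. *)
Lemma mxtrace_mul_sqr_le A B : (\tr (A * B)) ^+ 2 <= frob2 A * frob2 B.
Proof.
have trE : \tr (A * B) = \sum_u A u.1 u.2 * B u.2 u.1.
  rewrite -(pair_bigA _ (fun i j => A i j * B j i)) /=.
  by apply: eq_bigr => i _; rewrite mxE.
rewrite trE /frob2 [X in _ <= _ * X]exchange_big /=.
rewrite !(pair_bigA _ (fun i j => _)) /=.
exact: (@sum_mul_CauchySchwarz _ _ (fun u => A u.1 u.2) (fun u => B u.2 u.1)).
Qed.

Lemma frob2_trace A : A^T = A -> frob2 A = \tr (A ^+ 2).
Proof.
move=> Asym; rewrite /frob2; apply: eq_bigr => i _.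
rewrite expr2 mxE; apply: eq_bigr => j _.
by rewrite -{3}Asym mxE -expr2.
Qed.

Lemma trmx_exp A m : A^T = A -> (A ^+ m)^T = A ^+ m.
Proof.
move=> Asym; elim: m => [|m IH]; first by rewrite expr0 trmx1.
by rewrite exprSr trmx_mul IH Asym [LHS]/= -[LHS]/(A * A ^+ m) -exprS exprSr.
Qed.

(** Stated with integer powers so that no roots enter; the even outer power 4 also absorbs the
    possible negative sign of the trace for odd [t]. *)
Lemma mxtrace_exp_le M t : M^T = M -> (4 < t)%N ->
  (\tr (M ^+ t)) ^+ 4 <= (\tr (M ^+ 4)) ^+ t.
Proof.
move=> Msym t4; set F := \tr (M ^+ 4).
have FE : F = frob2 (M ^+ 2) by rewrite frob2_trace ?trmx_exp // -exprM.
have F0 : 0 <= F by rewrite FE frob2_ge0.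
have sqr_le (a b : R) : 0 <= a -> a <= b -> a ^+ 2 <= b ^+ 2.
  by move=> a0 ab; rewrite ler_pXn2r ?nnegrE // (le_trans a0).
have even_le s : (\tr (M ^+ (2 * s.+2))) ^+ 2 <= F ^+ s.+2.
  rewrite exprM exprS; apply: le_trans (mxtrace_mul_sqr_le _ _) _.
  by rewrite [leRHS]exprS FE ler_wpM2l ?frob2_ge0 ?frob2_exp.
have [s [->|->]] : exists s, t = (2 * s.+2)%N \/ t = (2 * s.+2).+1.
  by exists (t./2 - 2)%N; lia.
- rewrite -[4%N]/(2 * 2)%N [leLHS]exprM [(2 * s.+2)%N in leRHS]mulnC.
  by rewrite [leRHS]exprM; apply: sqr_le (sqr_ge0 _) (even_le _).
(* An odd power is not a power of [M ^+ 2], so a factor [M ^+ 3] is split off. The resulting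
   [\tr (M ^+ 6)] is the even case [s = 1], used at the end. *)
- have step1 : (\tr (M ^+ (2 * s.+2).+1)) ^+ 2 <= F ^+ s.+1 * \tr (M ^+ 6).
    have -> : M ^+ (2 * s.+2).+1 = (M ^+ 2) ^+ s.+1 * M ^+ 3.
      by rewrite -exprM -exprD; congr (_ ^+ _); rewrite !mulnS; lia.
    apply: le_trans (mxtrace_mul_sqr_le _ _) _.
    have -> : \tr (M ^+ 6) = frob2 (M ^+ 3).
      by rewrite frob2_trace ?trmx_exp // -exprM.
    by rewrite FE ler_wpM2r ?frob2_ge0 ?frob2_exp.
  rewrite -[4%N]/(2 * 2)%N [leLHS]exprM.
  apply: le_trans (sqr_le _ _ (sqr_ge0 _) step1) _.
  rewrite exprMn -exprM.
  have -> : ((2 * s.+2).+1 = s.+1 * 2 + 3)%N by lia.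
  by rewrite exprD ler_wpM2l ?exprn_ge0 // (even_le 1%N).
Qed.

End Matrices.

(** * Summing over labelings one coordinate at a time *)

Definition fcons (T : Type) (n : nat) (a : T) (g : {ffun 'I_n -> T}) :
    {ffun 'I_n.+1 -> T} :=
  [ffun i => if unlift ord0 i is Some j then g j else a].

Lemma fcons0 (T : Type) n a (g : {ffun 'I_n -> T}) : fcons a g ord0 = a.
Proof. by rewrite ffunE unlift_none. Qed.

Lemma fconsS (T : Type) n a (g : {ffun 'I_n -> T}) i :
  fcons a g (lift ord0 i) = g i.
Proof. by rewrite ffunE liftK. Qed.

Lemma sum_ffun_recl (V : nmodType) (T : finType) n
    (F : {ffun 'I_n.+1 -> T} -> V) :
  \sum_x F x = \sum_a \sum_(g : {ffun 'I_n -> T}) F (fcons a g).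
Proof.
rewrite (pair_bigA _ (fun a g => F (fcons a g))) /=.
rewrite (reindex (fun u : T * {ffun 'I_n -> T} => fcons u.1 u.2)) //=.
exists (fun x => (x ord0, [ffun i => x (lift ord0 i)])) => [[a g]|x] _ /=.
  by rewrite fcons0; congr pair; apply/ffunP => i; rewrite ffunE fconsS.
apply/ffunP => i; case: (unliftP ord0 i) => [j ->|->].
  by rewrite fconsS ffunE.
by rewrite fcons0.
Qed.

Lemma sum_ffun0 (V : nmodType) (T : finType) (F : {ffun 'I_0 -> T} -> V) :
  \sum_x F x = F [ffun i : 'I_0 => False_rect T (notF (ltn_ord i))].
Proof.
set z := [ffun i => _]; rewrite (big_pred1 z) // => x.
by symmetry; apply/eqP/ffunP; case.
Qed.

(** * Sums over graphs and products over edges *)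

Section ExpectationOverGraphs.
Variables (R : comNzRingType) (n : nat).

(** A graph amounts to an arbitrary set of increasing pairs, so expanding the product on the right
    by distributivity enumerates the graphs. *)
Lemma sum_sgraph_prod (c : 'I_n * 'I_n -> bool -> R) :
  \sum_(G : sgraph 'I_n)
    \prod_(u : 'I_n * 'I_n | (u.1 < u.2)%N) c u (adj G u.1 u.2) =
  \prod_(u : 'I_n * 'I_n | (u.1 < u.2)%N) (c u true + c u false).
Proof.
pose up := [set u : 'I_n * 'I_n | (u.1 < u.2)%N].
pose gr (J : {set 'I_n * 'I_n}) := sgraph_of_rel (fun i j => (i, j) \in J).
(* [bigA_distr] expands over all sets of pairs. The values 0 and 1 off the increasing pairs kill
   every set containing another pair and leave the remaining factors neutral. *)
pose c1 (u : 'I_n * 'I_n) := if (u.1 < u.2)%N then c u true else 0.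
pose c0 (u : 'I_n * 'I_n) := if (u.1 < u.2)%N then c u false else 1.
transitivity (\prod_u (c1 u + c0 u)); last first.
  by rewrite [RHS]big_mkcond; apply: eq_bigr => u _; rewrite /c1 /c0;
     case: ifP => // _; rewrite add0r.
rewrite bigA_distr (bigID (fun J : {set 'I_n * 'I_n} => J \subset up)) /=.
rewrite [X in _ + X]big1; last first.
  move=> J /subsetPn[u uJ]; rewrite inE => /negPf uup.
  by rewrite (bigD1 u) //= uJ /c1 uup mul0r.
rewrite addr0.
(* A graph is sent to its increasing pairs, with symmetric closure [gr] as the inverse. *)
rewrite (reindex_onto (fun G : sgraph 'I_n => adj_set G :&: up) gr); last first.
  move=> J Jup; apply/setP => -[i j]; rewrite !inE /=.
  apply/idP/idP => [/andP[/andP[ij /orP[//|jiJ]] lij]|ijJ].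
    by have := subsetP Jup _ jiJ; rewrite inE /= ltnNge (ltnW lij).
  have := subsetP Jup _ ijJ; rewrite inE /= ijJ => lij.
  by rewrite lij -(inj_eq val_inj) neq_ltn lij.
apply: eq_big => [G|G _].
  rewrite subsetIr; symmetry; apply/eqP/val_inj/setP => -[i j] /=.
  have /andP[/forallP Girr /forallP Gsym] := adj_setP G.
  rewrite !inE /= -(eqP (forallP (Gsym i) j)) -andb_orr.
  case: eqP => [->|/eqP ij]; first by rewrite (negPf (Girr j)).
  by rewrite -neq_ltn -(inj_eq val_inj) in ij *; rewrite ij andbT.
rewrite big_mkcond; apply: eq_bigr => u _.
rewrite !inE /c1 /c0 /adj -surjective_pairing.
by case: ltnP; rewrite ?andbF ?andbT //; case: ifP.
Qed.

(** [e] picks exactly one direction for each edge. This frees edge products from the order [i < j],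
    which suits neither cycles nor stars. *)
Definition orientation (H : sgraph 'I_n) (e : rel 'I_n) : Prop :=
  (forall i j, adj H i j = e i j || e j i) /\ (forall i j, e i j -> ~~ e j i).

Lemma orientation_of_rel (e : rel 'I_n) :
  (forall i j, e i j -> ~~ e j i) -> orientation (sgraph_of_rel e) e.
Proof.
move=> easym; split=> // i j; rewrite /adj inE /=.
case: eqP => [->|//]; rewrite orbb; apply/esym/negbTE/negP => ejj.
by have := easym _ _ ejj; rewrite ejj.
Qed.

(** The edges are split according to whether [e] points up or down; the downward ones are turned
    around by the symmetry of [F]. *)
Lemma prod_orientation (H : sgraph 'I_n) (e : rel 'I_n)
    (F : 'I_n -> 'I_n -> R) :
  orientation H e -> (forall i j, F i j = F j i) ->
  \prod_(i : 'I_n) \prod_(j : 'I_n | (i < j)%N && adj H i j) F i j =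
  \prod_i \prod_(j | e i j) F i j.
Proof.
move=> [adjE easym] Fsym.
have eirr i : e i i = false.
  by apply/negP => eii; have := easym _ _ eii; rewrite eii.
transitivity ((\prod_(i : 'I_n) \prod_(j : 'I_n | e i j && (i < j)%N) F i j) *
              (\prod_(i : 'I_n) \prod_(j : 'I_n | e j i && (i < j)%N) F i j)).
  rewrite -big_split /=; apply: eq_bigr => i _.
  rewrite (bigID (e i)) /=; congr (_ * _); apply: eq_bigl => j.
    by rewrite adjE; case: (e i j); rewrite ?andbT ?andbF.
  rewrite adjE; case: (boolP (e j i)) => [/easym /negPf ->|_].
    by rewrite /= !andbT.
  by rewrite orbF; case: (e i j); rewrite ?andbF.
rewrite [X in _ * X](exchange_big_dep predT) //= -big_split /=.
apply: eq_bigr => i _; rewrite [RHS](bigID (fun j : 'I_n => (i < j)%N)) /=.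
congr (_ * _); under eq_bigr do rewrite Fsym; apply: eq_bigl => j.
rewrite -leqNgt [(j <= i)%N]leq_eqVlt.
case: (eqVneq (j : nat) i) => [/val_inj ->|//].
by rewrite eirr.
Qed.

End ExpectationOverGraphs.

(** * Fourier coefficients as averages over labels *)

Section FourierCoefficients.
Variables (R : realType) (k : nat) (p : 'I_k -> R) (Q : 'M[R]_k).
Hypothesis hSBM : is_sbm p Q.

(** Given the labels, pairs are independent and the sum over graphs factors. With edge probability
    [q], a pair in [H] contributes [q - (1 - q)], which is the entry of [Q]; any other pair
    contributes [q + (1 - q) = 1]. *)
Lemma Phi_edges h (H : sgraph 'I_h) :
  Phi p Q H = \sum_x label_pmf p x *
    \prod_(i : 'I_h) \prod_(j : 'I_h | (i < j)%N && adj H i j) Q (x i) (x j).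
Proof.
rewrite /Phi /sbm_expectation /sbm_pmf.
under eq_bigr do rewrite mulr_suml.
rewrite exchange_big /=; apply: eq_bigr => x _.
under eq_bigr do rewrite -mulrA; rewrite -mulr_sumr; congr (_ * _).
pose q (u : 'I_h * 'I_h) := edge_prob Q (x u.1) (x u.2).
pose c (u : 'I_h * 'I_h) (b : bool) := (if b then q u else 1 - q u) *
  (if adj H u.1 u.2 then 2 * b%:R - 1 else 1).
transitivity (\sum_(G : sgraph 'I_h)
    \prod_(u : 'I_h * 'I_h | (u.1 < u.2)%N) c u (adj G u.1 u.2)).
  apply: eq_bigr => G _; rewrite /graph_pmf_given /fourier_char.
  rewrite -big_split /=.
  rewrite -(pair_big_dep predT (fun i j : 'I_h => (i < j)%N)
    (fun i j => c (i, j) (adj G i j))) /=.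
  apply: eq_bigr => i _; rewrite [X in _ * X]big_mkcondr -big_split /=.
  by apply: eq_bigr => j _; rewrite /c /=; case: (adj H i j).
rewrite sum_sgraph_prod.
rewrite -(pair_big_dep predT (fun i j : 'I_h => (i < j)%N)
  (fun i j => c (i, j) true + c (i, j) false)) /=.
apply: eq_bigr => i _; rewrite [RHS]big_mkcondr; apply: eq_bigr => j _.
by rewrite /c /q /edge_prob /=; case: (adj H i j); rewrite ?mulr1; field.
Qed.

Lemma Phi_orientation h (H : sgraph 'I_h) (e : rel 'I_h) :
  orientation H e ->
  Phi p Q H = \sum_x label_pmf p x * \prod_i \prod_(j | e i j) Q (x i) (x j).
Proof.
have [_ _ Qsym _] := hSBM.
move=> He; rewrite Phi_edges; apply: eq_bigr => x _; congr (_ * _).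
exact: (prod_orientation (F := fun i j => Q (x i) (x j)) He).
Qed.


(** * Cycles as traces of powers *)

Lemma label_pmf_fcons n a (g : {ffun 'I_n -> 'I_k}) :
  label_pmf p (fcons a g) = p a * label_pmf p g.
Proof.
rewrite /label_pmf big_ord_recl fcons0; congr (_ * _).
by apply: eq_bigr => i _; rewrite fconsS.
Qed.

(** [fcons a g] lists the [n.+1] vertices from which the walk takes a step; the final step to [b] is
    kept apart. For [b = a] the walk closes up, and [fcons a g] is a labeling of the cycle. *)
Lemma expr_walks (M : 'M[R]_k) n a b :
  (M ^+ n.+1) a b = \sum_(g : {ffun 'I_n -> 'I_k})
    (\prod_(i < n) M (fcons a g (widen_ord (leqnSn n) i)) (g i)) *
    M (fcons a g ord_max) b.
Proof.
elim: n a => [|n IH] a.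
  rewrite expr1 sum_ffun0 big_ord0 mul1r; congr (M _ b).
  by rewrite (_ : ord_max = ord0) ?fcons0 //; exact: val_inj.
rewrite exprS mxE sum_ffun_recl; apply: eq_bigr => c _.
rewrite IH mulr_sumr; apply: eq_bigr => g _; rewrite mulrA.
rewrite big_ord_recl (_ : widen_ord _ ord0 = ord0); last exact: val_inj.
rewrite !fcons0 (_ : ord_max = lift ord0 ord_max); last exact: val_inj.
rewrite fconsS; congr (_ * _ * _); apply: eq_bigr => i _.
rewrite (_ : widen_ord _ _ = lift ord0 (widen_ord (leqnSn n) i)).
  by rewrite !fconsS.
exact: val_inj.
Qed.

(** For [t = 2] the successor relation goes both ways between 0 and 1, and for [t = 1] it is a loop;
    hence the bound on [t]. *)
Lemma orientation_Cyc t : (2 < t)%N ->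
  orientation (Cyc t) (fun i j : 'I_t => j == (i.+1 %% t)%N :> nat).
Proof.
move=> t2; apply: orientation_of_rel => i j /eqP; apply: contraPN => /eqP.
have modS (l : 'I_t) : (l.+1 %% t = if l.+1 == t then 0 else l.+1)%N.
  case: eqP => [->|/eqP lt]; first exact: modnn.
  by rewrite modn_small // ltn_neqAle lt ltn_ord.
by rewrite !modS; do 2!case: eqP; lia.
Qed.

(** Splitting each weight into two square roots keeps the matrix symmetric, as [mxtrace_exp_le]
    requires. *)
Definition weighted_mx : 'M[R]_k :=
  \matrix_(a, b) (Num.sqrt (p a) * Q a b * Num.sqrt (p b)).

Lemma sqrtp_sqr a : Num.sqrt (p a) * Num.sqrt (p a) = p a.
Proof.
have [p01 _ _ _] := hSBM.
by rewrite -expr2 sqr_sqrtr // ltW //; case/andP: (p01 a).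
Qed.

Lemma trmx_weighted_mx : weighted_mx^T = weighted_mx.
Proof.
have [_ _ Qsym _] := hSBM.
by apply/matrixP => a b; rewrite !mxE Qsym; ring.
Qed.

Lemma Phi_Cyc t : (2 < t)%N -> Phi p Q (Cyc t) = \tr (weighted_mx ^+ t).
Proof.
move=> t2; rewrite (Phi_orientation (orientation_Cyc t2)).
case: t t2 => // n _.
rewrite sum_ffun_recl; apply: eq_bigr => a _; rewrite expr_walks.
apply: eq_bigr => g _; set x := fcons a g.
transitivity (\prod_i weighted_mx (x i) (x (ordS i))).
  under [RHS]eq_bigr do rewrite mxE.
  (* Each vertex of the cycle receives one square root from its outgoing edge and one from its
     incoming edge. Shifting the index by [ordS] pairs them into [p (x i)]. *)
  have shiftE : \prod_i Num.sqrt (p (x (ordS i))) = \prod_i Num.sqrt (p (x i)).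
    by rewrite [RHS](reindex_inj (@ordS_inj _)).
  rewrite !big_split /= shiftE.
  rewrite [RHS]mulrAC -[X in _ = X * _]big_split; congr (_ * _).
    by apply: eq_bigr => i _; rewrite /= sqrtp_sqr.
  apply: eq_bigr => i _; rewrite (big_pred1 (ordS i)) // => j.
rewrite big_ord_recr /=; congr (_ * _).
  apply: eq_bigr => i _; congr (weighted_mx _ _); rewrite -(fconsS a g) -/x.
  by congr (x _); apply: val_inj; rewrite /= modn_small ?ltnS.
by congr (weighted_mx _ _); rewrite -[RHS](fcons0 a g); congr (x _);
   apply: val_inj; rewrite /= modnn.
Qed.

(** * Codegrees, the 4-cycle and [K_2 d] *)

Definition codegree (a b : 'I_k) : R := \sum_c p c * (Q a c * Q b c).

Lemma Phi_Cyc4 : Phi p Q (Cyc 4) =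
  \sum_a \sum_b p a * p b * codegree a b ^+ 2.
Proof.
have [_ _ Qsym _] := hSBM.
rewrite Phi_Cyc // (exprM _ 2 2) -frob2_trace; last first.
  by rewrite trmx_exp // trmx_weighted_mx.
apply: eq_bigr => a _; apply: eq_bigr => b _.
have -> : (weighted_mx ^+ 2) a b =
    Num.sqrt (p a) * Num.sqrt (p b) * codegree a b.
  rewrite expr2 mxE mulr_sumr; apply: eq_bigr => c _.
  by rewrite !mxE -[in RHS](sqrtp_sqr c) (Qsym c b); ring.
by rewrite !exprMn !(expr2 (Num.sqrt _)) !sqrtp_sqr.
Qed.

(** Once the two vertices on the small side have labels [a] and [b], the other [d] labels are
    independent, and each contributes a factor [codegree a b]. *)
Lemma Phi_K_2 d : Phi p Q (K_2 d) =
  \sum_a \sum_b p a * p b * codegree a b ^+ d.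
Proof.
rewrite (@Phi_orientation _ _ (fun i j : 'I_(2 + d) => (i < 2 <= j)%N));
  last by apply: orientation_of_rel => i j; lia.
rewrite sum_ffun_recl; apply: eq_bigr => a _.
rewrite sum_ffun_recl; apply: eq_bigr => b _.
rewrite -[d in codegree a b ^+ d]card_ord -prodr_const.
rewrite bigA_distr_bigA mulr_sumr; apply: eq_bigr => g _.
rewrite 2!label_pmf_fcons !mulrA -!mulrA; congr (_ * (_ * _)).
rewrite big_split /=; congr (_ * _).
rewrite 2!big_ord_recl [X in _ * (_ * X)]big1 => [|i _]; last first.
  by apply: big_pred0 => j.
rewrite mulr1 big_split /= !fcons0 !fconsS !fcons0; congr (_ * _).
  rewrite big_mkcond 2!big_ord_recl /= !mul1r.
  by apply: eq_bigr => i _; rewrite !fconsS.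
rewrite big_mkcond 2!big_ord_recl /= !mul1r.
by apply: eq_bigr => i _; rewrite !fconsS.
Qed.

(** * The degree bound, by resampling one label *)

Lemma label_pmf_ge0 n (x : {ffun 'I_n -> 'I_k}) : 0 <= label_pmf p x.
Proof.
have [p01 _ _ _] := hSBM.
by apply: prodr_ge0 => i _; apply: ltW; case/andP: (p01 (x i)).
Qed.

Lemma sum_label_pmf n : \sum_(x : {ffun 'I_n -> 'I_k}) label_pmf p x = 1.
Proof.
have [_ p1 _ _] := hSBM.
rewrite /label_pmf -(bigA_distr_bigA (fun (i : 'I_n) a => p a)) /=.
by apply: big1 => i _.
Qed.

Definition relabel n (x : {ffun 'I_n -> 'I_k}) (v : 'I_n) (a : 'I_k) :
    {ffun 'I_n -> 'I_k} := [ffun i => if i == v then a else x i].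

Lemma relabelK n (x : {ffun 'I_n -> 'I_k}) v a :
  relabel (relabel x v a) v (x v) = x.
Proof. by apply/ffunP => i; rewrite !ffunE; case: eqP => // ->. Qed.

(* The exchange (x, a) <-> (relabel x v a, x v) preserves the product law. *)
Lemma sum_label_pmf_resample n (v : 'I_n) (f : {ffun 'I_n -> 'I_k} -> R) :
  \sum_x label_pmf p x * f x =
  \sum_x label_pmf p x * \sum_a p a * f (relabel x v a).
Proof.
have [_ p1 _ _] := hSBM.
transitivity (\sum_x \sum_a label_pmf p x * p a * f x).
  by apply: eq_bigr => x _; rewrite -mulr_suml -mulr_sumr p1 mulr1.
under [RHS]eq_bigr do rewrite mulr_sumr.
rewrite !pair_bigA /=.
rewrite (reindex_inj (h := fun u => (relabel u.1 v u.2, u.1 v))) /=; last first.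
  apply: (can_inj (g := fun u => (relabel u.1 v u.2, u.1 v))) => -[x a] /=.
  by rewrite relabelK ffunE eqxx.
apply: eq_bigr => -[x a] _ /=; rewrite mulrA; congr (_ * _).
rewrite /label_pmf [in LHS](bigD1 v) //= [in RHS](bigD1 v) //= ffunE eqxx.
under eq_bigr => i iv do rewrite ffunE (negPf iv).
by ring.
Qed.

Lemma Phi_sqr_le_K_2 h (H : sgraph 'I_h) (v : 'I_h) :
  (Phi p Q H) ^+ 2 <= Phi p Q (K_2 (degree H v)).
Proof.
have [p01 p1 Qsym Q1] := hSBM.
have /andP[/forallP Hirr /forallP Hsym] := adj_setP H.
have adjC i j : adj H i j = adj H j i by exact/eqP/(forallP (Hsym i)).
have adjxx i : adj H i i = false by exact/negbTE/Hirr.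
(* All edges at [v] point away from [v] and the others point upward. The factor of tail [v] is then
   exactly the star at [v], and [rest] does not depend on the label of [v]. *)
pose e : rel 'I_h := fun i j =>
  adj H i j && ((i == v) || (j != v) && (i < j)%N).
have He : orientation H e.
  split=> i j; rewrite /e (adjC j i).
    case: (eqVneq i j) => [->|ij]; first by rewrite adjxx.
    rewrite -andb_orr; case: (eqVneq i v) => [_|]; first by rewrite andbT.
    case: (eqVneq j v) => [_|]; first by rewrite orbT andbT.
    by rewrite /= -neq_ltn (inj_eq val_inj) ij andbT.
  case/andP => Hij; rewrite Hij /=.
  case: (eqVneq i v) Hij => [->|_] Hij /=; last by case: eqP => //=; lia.
  by case: eqP Hij => [->|//]; rewrite adjxx.
pose rest (x : {ffun 'I_h -> 'I_k}) :=
  \prod_(i | i != v) \prod_(j | e i j) Q (x i) (x j).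
pose star a (x : {ffun 'I_h -> 'I_k}) := \prod_(j | adj H v j) Q a (x j).
pose g (x : {ffun 'I_h -> 'I_k}) := \sum_a p a * star a x.
have PhiE : Phi p Q H = \sum_x label_pmf p x * (rest x * g x).
  rewrite (Phi_orientation He) (sum_label_pmf_resample v).
  apply: eq_bigr => x _; congr (_ * _); rewrite /g mulr_sumr.
  apply: eq_bigr => a _; rewrite (bigD1 v) //= [RHS]mulrCA.
  congr (_ * _); rewrite mulrC; congr (_ * _).
    apply: eq_bigr => i iv; apply: eq_bigr => j /andP[_].
    rewrite (negPf iv) /= => /andP[jv _].
    by rewrite !ffunE (negPf iv) (negPf jv).
  rewrite /star; apply: eq_big => [j|j /andP[Hvj _]].
    by rewrite /e eqxx andbT.
  rewrite !ffunE eqxx; case: eqP Hvj => [->|//].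
  by rewrite adjxx.
have rest1 x : rest x ^+ 2 <= 1.
  rewrite -real_normK ?num_real // exprn_ile1 // /rest normr_prod.
  apply: prodr_ile1 => i _; rewrite normr_ge0 normr_prod /=.
  by apply: prodr_ile1 => j _; rewrite normr_ge0 ler_norml Q1.
rewrite PhiE; apply: le_trans (sum_CauchySchwarz _ _ (@label_pmf_ge0 _)) _.
(* Squaring [g] draws two independent labels [a] and [b] for [v]. They label the two-vertex side of
   the complete bipartite graph, and the neighbours of [v] form the other side. *)
have gE : \sum_x label_pmf p x * g x ^+ 2 = Phi p Q (K_2 (degree H v)).
  rewrite Phi_K_2; under eq_bigr => x _ do
    rewrite expr2 big_distrlr mulr_sumr /=.
  rewrite exchange_big; apply: eq_bigr => a _.
  under eq_bigr do rewrite mulr_sumr.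
  rewrite exchange_big; apply: eq_bigr => b _ /=.
  (* Non-neighbours are included with factor [\sum_c p c = 1], so that expanding the product yields
     a sum over labelings of all [h] vertices. *)
  have -> : codegree a b ^+ degree H v = \prod_(i : 'I_h) \sum_c
     p c * (if adj H v i then Q a c * Q b c else 1).
    rewrite /degree -prodr_const big_mkcond; apply: eq_bigr => i _.
    rewrite inE; case: ifP => // _; by under [RHS]eq_bigr do rewrite mulr1.
  rewrite bigA_distr_bigA mulr_sumr; apply: eq_bigr => x _.
  rewrite big_split /= -big_mkcond big_split /= -/(label_pmf p x) /star.
  by ring.
rewrite gE ler_piMl //.
  rewrite -gE; apply: sumr_ge0 => x _.
  by rewrite mulr_ge0 ?label_pmf_ge0 ?sqr_ge0.
rewrite -[leRHS](sum_label_pmf h); apply: ler_sum => x _.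
by rewrite ler_piMr ?label_pmf_ge0.
Qed.

(** Given labels [c], [d] of vertices 2 and 3, the nonadjacent vertices 0 and 1 are independent and
    give the squared codegree; edge 23 adds only a factor of absolute value at most 1. The bound
    also shows that the coefficient of the 4-cycle is nonnegative. *)
Lemma norm_Phi_K4minus : `|Phi p Q K4minus| <= Phi p Q (Cyc 4).
Proof.
have [p01 p1 Qsym Q1] := hSBM.
have p0 a : 0 <= p a by apply: ltW; case/andP: (p01 a).
have -> : Phi p Q K4minus =
    \sum_c \sum_d p c * p d * Q c d * codegree c d ^+ 2.
  rewrite (@Phi_orientation _ _ (fun i j : 'I_4 => (i < j)%N && (1 < j)%N));
    last by apply: orientation_of_rel => i j; lia.
  transitivity (\sum_a \sum_b \sum_c \sum_d p a * (p b * (p c * p d)) *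
      (Q a c * Q a d * (Q b c * Q b d * Q c d))).
    rewrite sum_ffun_recl; apply: eq_bigr => a _.
    rewrite sum_ffun_recl; apply: eq_bigr => b _.
    rewrite sum_ffun_recl; apply: eq_bigr => c _.
    rewrite sum_ffun_recl; apply: eq_bigr => d _.
    rewrite sum_ffun0 !label_pmf_fcons /label_pmf big_ord0 mulr1 !mulrA.
    rewrite -!(mulrA (p a * p b * p c * p d)); congr (_ * _).
    under eq_bigr do rewrite big_mkcond.
    rewrite !big_ord_recl !big_ord0 /= !(fcons0, fconsS).
    by ring.
  rewrite pair_bigA; under eq_bigr do rewrite pair_bigA.
  rewrite exchange_big [RHS]pair_bigA; apply: eq_bigr => -[c d] _ /=.
  rewrite expr2 /codegree big_distrlr pair_bigA mulr_sumr.
  apply: eq_bigr => -[a b] _ /=.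
  by rewrite (Qsym c a) (Qsym c b) (Qsym d a) (Qsym d b); ring.
rewrite Phi_Cyc4.
apply: le_trans (ler_norm_sum _ _ _) _; apply: ler_sum => c _.
apply: le_trans (ler_norm_sum _ _ _) _; apply: ler_sum => d _.
have w0 : 0 <= p c * p d * codegree c d ^+ 2.
  by rewrite mulr_ge0 ?sqr_ge0 // mulr_ge0 ?p0.
by rewrite mulrAC normrM (ger0_norm w0) ler_piMr // ler_norml Q1.
Qed.

End FourierCoefficients.

(** * Taking roots and assembling the theorem *)

Lemma powR_root_le (R : realType) (a b : R) (s t : nat) :
  (0 < s)%N -> (0 < t)%N -> 0 <= a -> 0 <= b -> a ^+ s <= b ^+ t ->
  a `^ t%:R^-1 <= b `^ s%:R^-1.
Proof.
move=> s0 t0 a0 b0 ab.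
(* Both sides are rewritten as powers with the common exponent [1 / (s * t)], of [a ^+ s] and
   [b ^+ t]. *)
have root (c : R) m l : (0 < m)%N -> 0 <= c ->
    c `^ l%:R^-1 = (c ^+ m) `^ (m%:R^-1 * l%:R^-1).
  move=> m0 c0; rewrite -powR_mulrn // -powRrM mulrA mulfV ?mul1r //.
  by rewrite pnatr_eq0 -lt0n.
rewrite (root a s t) // (root b t s) // [_^-1 * s%:R^-1]mulrC.
by rewrite ge0_ler_powR ?nnegrE ?exprn_ge0 // mulr_ge0 // invr_ge0 ler0n.
Qed.

Theorem theorem1p5 (R : realType) (k : nat) (p : 'I_k -> R) (Q : 'M[R]_k)
    (hSBM : is_sbm p Q) :
  [/\ forall t : nat, (5 <= t)%N -> Psi p Q (Cyc t) <= Psi p Q (Cyc 4),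
      forall (h : nat) (H : sgraph 'I_h) (d : nat),
        (exists v : 'I_h, degree H v = d) ->
        `|Phi p Q H| <= `|Phi p Q (K_2 d)| `^ (2^-1)
    & Psi p Q K4minus <= Psi p Q (Cyc 4)].
Proof.
have C4_ge0 : 0 <= Phi p Q (Cyc 4).
  exact: le_trans (normr_ge0 _) (norm_Phi_K4minus hSBM).
split=> [t t5|h H d [v <-]|].
- rewrite /Psi; apply: powR_root_le => //; first exact: leq_trans t5.
  rewrite (ger0_norm C4_ge0) -normrX ger0_norm; last first.
    (* The absolute value on the coefficient of [Cyc t] disappears because its fourth power is a
       square. *)
    by rewrite -[4%N]/(2 * 2)%N exprM sqr_ge0.
  rewrite !(Phi_Cyc hSBM) //; last by lia.
  by apply: mxtrace_exp_le => //; exact: trmx_weighted_mx.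
- have := Phi_sqr_le_K_2 hSBM H v.
  set a := Phi p Q H; set b := Phi p Q _ => ab.
  have b0 : 0 <= b := le_trans (sqr_ge0 _) ab.
  by rewrite powR12_sqrt // (ger0_norm b0) -sqrtr_sqr ler_sqrt.
- rewrite /Psi ge0_ler_powR ?nnegrE ?normr_ge0 ?invr_ge0 ?ler0n //.
  by rewrite [leRHS]ger0_norm // norm_Phi_K4minus.
Qed.
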